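(* Let $\lambda$ be a nonzero real number. For every integer $n\ge 0$, $$\mathcal{E}_{n,\lambda}=\sum_{k=0}^{n}{n \brace k}_{\lambda}(-1)^{k}k!\,2^{-k}.$$
   Context: The degenerate falling factorials are $(x)_{0,\lambda}=1$ and $(x)_{n,\lambda}=x(x-\lambda)(x-2\lambda)\cdots(x-(n-1)\lambda)$ for $n\ge 1$; the falling factorials are $(x)_0=1$, $(x)_n=x(x-1)\cdots(x-n+1)$ for $n\ge1$. The degenerate Stirling numbers of the second kind ${n \brace k}_{\lambda}$ ($0\le k\le n$) are defined by the polynomial identity $(x)_{n,\lambda}=\sum_{k=0}^{n}{n \brace k}_{\lambda}(x)_k$, $n\ge 0$. The degenerate exponential is $e_{\lambda}(t)=\sum_{n=0}^{\infty}(1)_{n,\lambda}\frac{t^{n}}{n!}$ (that is, $(1+\lambda t)^{1/\lambda}$). The degenerate Euler numbers $\mathcal{E}_{n,\lambda}$ are defined by $\frac{2}{e_{\lambda}(t)+1}=\sum_{n=0}^{\infty}\mathcal{E}_{n,\lambda}\frac{t^{n}}{n!}$. *)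

(* Defs.v *)
From HB Require Import structures.
From mathcomp Require Import all_boot all_order all_algebra.
From mathcomp Require Import boolp reals.

Set Implicit Arguments.
Unset Strict Implicit.
Unset Printing Implicit Defensive.

Import Order.TTheory GRing.Theory Num.Theory.
Local Open Scope ring_scope.

(* Formal power series, as a commutative ring with units.  The coefficients   *)
(* are wrapped in a record because nat -> K already carries the pointwise     *)
(* ring structure of mathcomp-analysis.                                       *)
Record fps (K : Type) := Fps { fps_coef : nat -> K }.

Section FpsRing.
Variable K : fieldType.
Implicit Types f g h : fps K.

HB.instance Definition _ := gen_eqMixin (fps K).
HB.instance Definition _ := gen_choiceMixin (fps K).

Lemma fpsP f g : (forall n, fps_coef f n = fps_coef g n) -> f = g.
Proof. by case: f g => [f] [g] /= /funext ->. Qed.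

Definition fps_zero : fps K := Fps (fun _ => 0).
Definition fps_one : fps K := Fps (fun n => (n == 0)%:R).
Definition fps_opp f : fps K := Fps (fun n => - fps_coef f n).
Definition fps_add f g : fps K := Fps (fun n => fps_coef f n + fps_coef g n).
Definition fps_mul f g : fps K :=
  Fps (fun n => \sum_(i < n.+1) fps_coef f i * fps_coef g (n - i)).

Fact fps_addA : associative fps_add.
Proof. by move=> f g h; apply: fpsP => n /=; rewrite addrA. Qed.
Fact fps_addC : commutative fps_add.
Proof. by move=> f g; apply: fpsP => n /=; rewrite addrC. Qed.
Fact fps_add0 : left_id fps_zero fps_add.
Proof. by move=> f; apply: fpsP => n /=; rewrite add0r. Qed.
Fact fps_addN : left_inverse fps_zero fps_opp fps_add.
Proof. by move=> f; apply: fpsP => n /=; rewrite addNr. Qed.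

HB.instance Definition _ :=
  GRing.isZmodule.Build (fps K) fps_addA fps_addC fps_add0 fps_addN.

Let trunc N f : {poly K} := \poly_(i < N) fps_coef f i.

Let mul_trunc N f g n : (n < N)%N ->
  fps_coef (fps_mul f g) n = (trunc N f * trunc N g)`_n.
Proof.
move=> nN; rewrite coefM; apply: eq_bigr => i _; rewrite !coef_poly.
by rewrite (leq_ltn_trans (leq_subr _ _) nN) (leq_ltn_trans _ nN) // -ltnS.
Qed.

Fact fps_mulC : commutative fps_mul.
Proof.
by move=> f g; apply: fpsP => n; rewrite !(mul_trunc _ _ (ltnSn n)) mulrC.
Qed.

Fact fps_mulA : associative fps_mul.
Proof.
move=> f g h; apply: fpsP => n.
transitivity (trunc n.+1 f * (trunc n.+1 g * trunc n.+1 h))`_n.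
  rewrite coefM; apply: eq_bigr => i _.
  rewrite (mul_trunc (N := n.+1)) ?ltnS ?leq_subr // !coef_poly.
  by rewrite ltn_ord.
rewrite mulrA coefM; apply: eq_bigr => i _.
by rewrite -(mul_trunc (N := n.+1)) // !coef_poly ltnS leq_subr.
Qed.

Fact fps_mul1 : left_id fps_one fps_mul.
Proof.
move=> f; apply: fpsP => n /=.
rewrite big_ord_recl /= mul1r subn0 big1 ?addr0 // => i _.
by rewrite mul0r.
Qed.

Fact fps_mulDl : left_distributive fps_mul fps_add.
Proof.
move=> f g h; apply: fpsP => n /=; rewrite -big_split /=.
by apply: eq_bigr => i _; rewrite mulrDl.
Qed.

Fact fps_one_neq0 : fps_one != 0 :> fps K.
Proof.
apply/eqP => /(congr1 (fun f => fps_coef f 0)) /= /eqP.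
by rewrite oner_eq0.
Qed.

HB.instance Definition _ := GRing.Zmodule_isComNzRing.Build (fps K)
  fps_mulA fps_mulC fps_mul1 fps_mulDl fps_one_neq0.

(* The first n + 1 coefficients g_0, ..., g_n of the inverse of f, from       *)
(* f_0 g_0 = 1 and f_0 g_n = - (f_1 g_(n-1) + ... + f_n g_0).                 *)
Fixpoint fps_inv_seq f n : seq K :=
  if n is m.+1 then
    let s := fps_inv_seq f m in
    rcons s (- (fps_coef f 0)^-1 *
               \sum_(i < m.+1) fps_coef f i.+1 * s`_(m - i))
  else [:: (fps_coef f 0)^-1].

Definition fps_unit : pred (fps K) := fun f => fps_coef f 0 != 0.
Definition fps_inv f : fps K :=
  if fps_unit f then Fps (fun n => (fps_inv_seq f n)`_n) else f.

Let size_inv_seq f n : size (fps_inv_seq f n) = n.+1.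
Proof. by elim: n => //= n IH; rewrite size_rcons IH. Qed.

Let nth_inv_seq f n i : (i <= n)%N ->
  (fps_inv_seq f n)`_i = (fps_inv_seq f i)`_i.
Proof.
elim: n => [|n IH]; first by rewrite leqn0 => /eqP ->.
rewrite leq_eqVlt => /predU1P[-> //|]; rewrite ltnS => le_in.
by rewrite /= nth_rcons size_inv_seq ltnS le_in IH.
Qed.

Fact fps_mulV : {in fps_unit, left_inverse 1 fps_inv *%R}.
Proof.
move=> f fU; have f0 : fps_coef f 0 != 0 by [].
have {}fU : fps_unit f by [].
rewrite mulrC; apply: fpsP => -[|n].
  by rewrite /= big_ord1 /fps_inv fU /= mulfV.
rewrite /fps_inv fU [LHS]/= big_ord_recl subn0 /=.
rewrite nth_rcons size_inv_seq ltnn eqxx mulrA mulrN mulfV // mulN1r.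
apply/eqP; rewrite addrC subr_eq0; apply/eqP/eq_bigr => i _.
by rewrite subSS -(@nth_inv_seq f n) ?leq_subr.
Qed.

Fact fps_unitP f g : g * f = 1 -> fps_unit f.
Proof.
move=> /(congr1 (fun h => fps_coef h 0)) /=; rewrite big_ord1 /= => gf.
by apply/eqP => f0; move/eqP: gf; rewrite f0 mulr0 eq_sym oner_eq0.
Qed.

Fact fps_inv_out : {in [predC fps_unit], fps_inv =1 id}.
Proof. by move=> f fNU; rewrite /fps_inv (negbTE (fNU : ~~ fps_unit f)). Qed.

HB.instance Definition _ := GRing.ComNzRing_hasMulInverse.Build (fps K)
  fps_mulV fps_unitP fps_inv_out.

Definition egf (a : nat -> K) : fps K := Fps (fun n => a n / n`!%:R).

End FpsRing.

Section DegenerateNumbers.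
Variable R : realType.
Implicit Types (lambda : R) (S : nat -> nat -> R).

Definition falling n : {poly R} := \prod_(i < n) ('X - i%:R%:P).

Definition degenerate_falling lambda n : {poly R} :=
  \prod_(i < n) ('X - (i%:R * lambda)%:P).

(* The values S n k with k > n are left unconstrained.                        *)
Definition degenerate_stirling2 lambda S : Prop :=
  forall n, degenerate_falling lambda n = \sum_(k < n.+1) S n k *: falling k.

Definition degenerate_exp lambda : fps R :=
  egf (fun n => (degenerate_falling lambda n).[1]).

Definition degenerate_euler lambda n : R :=
  n`!%:R * fps_coef (2 / (degenerate_exp lambda + 1)) n.

Lemma degenerate_exp1_unit lambda : degenerate_exp lambda + 1 \is a GRing.unit.
Proof.
rewrite unfold_in /= /fps_unit /= /degenerate_falling big_ord0 hornerC.
by rewrite fact0 divr1 -[1 + _]/(2%:R) pnatr_eq0.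
Qed.

Lemma degenerate_euler_egf lambda :
  2 / (degenerate_exp lambda + 1) = egf (degenerate_euler lambda).
Proof.
apply: fpsP => n; rewrite [RHS]/= /degenerate_euler mulrAC mulfV ?mul1r //.
by rewrite pnatr_eq0 -lt0n fact_gt0.
Qed.

Let fallingS n : falling n.+1 = falling n * ('X - n%:R%:P).
Proof. by rewrite /falling big_ord_recr. Qed.

Let size_falling n : size (falling n) = n.+1.
Proof.
by rewrite /falling size_prod_XsubC /index_enum -enumT size_enum_ord.
Qed.

Lemma degenerate_stirling2_exists lambda :
  exists S, degenerate_stirling2 lambda S.
Proof.
suff H n : exists s : nat -> R,
    degenerate_falling lambda n = \sum_(k < n.+1) s k *: falling k.
  by have [S HS] := choice H; exists S.
elim: n => [|n [s IH]].
  exists (fun _ => 1).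
  by rewrite big_ord1 scale1r /degenerate_falling /falling !big_ord0.
exists (fun k => (if k is j.+1 then s j else 0)
  + (if (k <= n)%N then (k%:R - n%:R * lambda) * s k else 0)).
rewrite /degenerate_falling big_ord_recr /= -/(degenerate_falling lambda n) IH.
under [RHS]eq_bigr do rewrite scalerDl.
rewrite big_split /=.
rewrite [X in _ = X + _]big_ord_recl /= scale0r add0r.
rewrite [X in _ = _ + X]big_ord_recr /= ltnn scale0r addr0.
rewrite mulr_suml -big_split /=; apply: eq_bigr => k _.
rewrite -ltnS ltn_ord fallingS [_ * s k]mulrC -scalerA -scalerDr -scalerAl.
congr (_ *: _).
rewrite -mul_polyC [_%:P * _]mulrC -mulrDr; congr (_ * _).
by rewrite polyCB addrA subrK.
Qed.

Lemma degenerate_stirling2_unique lambda S S' n k :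
  degenerate_stirling2 lambda S -> degenerate_stirling2 lambda S' ->
  (k <= n)%N -> S n k = S' n k.
Proof.
move=> /(_ n) HS /(_ n) /eqP; rewrite HS -subr_eq0 -sumrB.
under eq_bigr do rewrite -scalerBl.
move: (S' n) (S n) {HS} => s s'; elim: n => [|m IH] + le_km.
  move: le_km; rewrite leqn0 => /eqP ->.
  rewrite big_ord1 /falling big_ord0 scaler_eq0 oner_eq0 orbF subr_eq0.
  by move/eqP.
rewrite big_ord_recr /= => /eqP H.
set p := \sum_(i < m.+1) _ in H *.
have le_size : (size p <= m.+1)%N.
  apply: (leq_trans (size_sum _ _ _)); apply/bigmax_leqP => i _.
  by rewrite (leq_trans (size_scale_leq _ _)) // size_falling.
have eq_s : s' m.+1 - s m.+1 = 0.
  have /eqP := congr1 (fun q : {poly R} => q`_m.+1) H.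
  rewrite coefD coefZ coef0 nth_default // add0r mulf_eq0 => /orP[/eqP //|].
  have -> : (falling m.+1)`_m.+1 = lead_coef (falling m.+1).
    by rewrite lead_coefE size_falling.
  by rewrite lead_coef_eq0 -size_poly_eq0 size_falling.
move: H; rewrite eq_s scale0r addr0 => /eqP H.
move: le_km; rewrite leq_eqVlt => /predU1P[->|]; last exact: IH.
by apply/eqP; rewrite -subr_eq0 eq_s.
Qed.

End DegenerateNumbers.

(* Main.v *)
Require Import Defs.
From HB Require Import structures.
From mathcomp Require Import all_boot all_order all_algebra.
From mathcomp Require Import reals.
From mathcomp Require Import ring.

Import Order.TTheory GRing.Theory Num.Theory.
Local Open Scope ring_scope.

(** The generating function 2 / (e_lambda + 1) is read umbrally.  Let D be the
    forward difference, so that the shift p(x) |-> p(x + 1) is 1 + D, and let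
    L be the linear functional p |-> sum_k (-1/2)^k (D^k p)(0), that is,
    evaluation at 0 of (1 + D/2)^-1 p.

    Since the shift plus the identity is 2 (1 + D/2), one has
      L (p(x + 1)) + L (p(x)) = 2 p(0),
    a telescoping sum ([euler_functional_shift]).  On the falling factorial
    basis D^k (x)_j = j (j - 1) ... (j - k + 1) (x)_(j - k), hence
    L ((x)_j) = (-1)^j j! 2^-j, and by the definition of the Stirling numbers
    L ((x)_(n,lambda)) is the right-hand side of the theorem
    ([euler_functional_degenerate_falling]).

    Finally, apply the first identity to p = (x)_(n,lambda).  The Vandermonde
    formula expands (x + 1)_(n,lambda) as the binomial convolution of
    (x)_(i,lambda) and (1)_(n-i,lambda), the latter being the coefficients of
    e_lambda, and (0)_(n,lambda) vanishes unless n = 0.  So the identity says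
    that the exponential generating function of L ((x)_(n,lambda)) multiplied
    by e_lambda + 1 is 2, which characterizes the degenerate Euler numbers. *)

Section UmbralEuler.
Set Implicit Arguments.
Unset Strict Implicit.
Variable R : realType.
Implicit Types (p q : {poly R}) (lambda c : R).

(** * Forward differences *)

Definition forward_diff p : {poly R} := p \Po ('X + 1) - p.

Definition forward_diffn k p : {poly R} := iter k forward_diff p.

Fact forward_diffn_is_linear k : linear (forward_diffn k).
Proof.
elim: k => [//|k IHk] a p q.
rewrite /forward_diffn !iterS -!/(forward_diffn k _) IHk /forward_diff.
by rewrite comp_polyD comp_polyZ scalerBr opprD addrACA.
Qed.

HB.instance Definition _ k :=
  GRing.isLinear.Build R {poly R} {poly R} *:%R (forward_diffn k)
    (forward_diffn_is_linear k).

Lemma fallingSr n : falling R n.+1 = falling R n * ('X - n%:R%:P).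
Proof. by rewrite /falling big_ord_recr. Qed.

Lemma falling_shift n :
  falling R n.+1 \Po ('X + 1) = ('X + 1) * falling R n.
Proof.
elim: n => [|n IHn].
  by rewrite /falling big_ord1 big_ord0 subr0 comp_polyX mulr1.
rewrite fallingSr comp_polyM IHn fallingSr -mulrA; congr (_ * (_ * _)).
by rewrite comp_polyB comp_polyX comp_polyC -natr1 polyCD; ring.
Qed.

Lemma forward_diff_falling n :
  forward_diff (falling R n) = n%:R *: falling R n.-1.
Proof.
case: n => [|n].
  by rewrite scale0r /forward_diff /falling big_ord0 -polyC1 comp_polyC subrr.
rewrite /forward_diff falling_shift fallingSr /= -mul_polyC -natr1 polyCD.
ring.
Qed.

Lemma forward_diffn_falling k n :
  forward_diffn k (falling R n) = (n ^_ k)%:R *: falling R (n - k).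
Proof.
elim: k => [|k IHk]; first by rewrite ffactn0 subn0 scale1r.
have -> : forward_diffn k.+1 (falling R n) =
    forward_diffn 1 (forward_diffn k (falling R n)) by [].
rewrite IHk linearZ [X in _ *: X = _]forward_diff_falling scalerA.
by rewrite -natrM -ffactnSr subnS.
Qed.

Lemma falling_horner0 n : (falling R n).[0] = (n == 0)%:R.
Proof.
case: n => [|n]; first by rewrite /falling big_ord0 hornerC.
by rewrite /falling big_ord_recl hornerM subr0 hornerX mul0r.
Qed.

(** * The functional (1 + D/2)^-1 at 0 *)

(** The geometric series is cut at [N]: its value on polynomials of degree less
    than [N] is the full sum, and linearity needs no convergence argument. *)
Definition euler_functional N p : R :=
  \sum_(k < N) (- 2^-1) ^+ k * (forward_diffn k p).[0].

Fact euler_functional_is_linear N : scalar (euler_functional N).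
Proof.
move=> a p q; rewrite /euler_functional mulr_sumr -big_split /=.
by apply: eq_bigr => k _; rewrite linearP hornerD hornerZ; ring.
Qed.

HB.instance Definition _ N :=
  GRing.isLinear.Build R {poly R} R *%R (euler_functional N)
    (euler_functional_is_linear N).

(** With c_k = (-1/2)^k (D^k p)(0), the left-hand side is the functional at
    2 p + D p, whose k-th term is 2 c_k - 2 c_(k+1); the sum telescopes, and
    the hypothesis kills the last term 2 c_N. *)
Lemma euler_functional_shift N p : forward_diffn N p = 0 ->
  euler_functional N (p \Po ('X + 1)) + euler_functional N p = 2 * p.[0].
Proof.
move=> DNp0; pose c k := - 2 * ((- 2^-1) ^+ k * (forward_diffn k p).[0]).
have -> : 2 * p.[0] = c N - c 0%N.
  by rewrite /c DNp0 horner0 expr0 /forward_diffn /=; ring.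
rewrite -telescope_sumr // big_mkord /euler_functional -big_split /=.
apply: eq_bigr => k _; have -> : p \Po ('X + 1) = p + forward_diff p.
  by rewrite /forward_diff [RHS]addrC subrK.
rewrite linearD /= hornerD /c exprS.
have -> : forward_diffn k (forward_diff p) = forward_diffn k.+1 p.
  by rewrite /forward_diffn iterSr.
by field.
Qed.

Lemma euler_functional_falling N n : (n < N)%N ->
  euler_functional N (falling R n) = (-1) ^+ n * n`!%:R * 2 ^- n.
Proof.
move=> ltnN; rewrite /euler_functional (bigD1 (Ordinal ltnN)) //=.
rewrite forward_diffn_falling hornerZ falling_horner0 subnn ffactnn.
rewrite big1 => [|k neq_kn].
  by rewrite addr0 mulr1 [(- 2^-1) ^+ _]exprNn exprVn; ring.
rewrite forward_diffn_falling hornerZ falling_horner0.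
case: (ltngtP k n) => [ltkn|ltnk|eqkn].
- by rewrite subn_eq0 leqNgt ltkn /= !mulr0.
- by rewrite ffact_small // mul0r mulr0.
- by rewrite -val_eqE /= eqkn eqxx in neq_kn.
Qed.

(** * Degenerate falling factorials *)

Lemma degenerate_fallingSr lambda n : degenerate_falling lambda n.+1 =
  degenerate_falling lambda n * ('X - (n%:R * lambda)%:P).
Proof. by rewrite /degenerate_falling big_ord_recr. Qed.

Lemma degenerate_falling_horner0 lambda n :
  (degenerate_falling lambda n).[0] = (n == 0)%:R.
Proof.
case: n => [|n]; first by rewrite /degenerate_falling big_ord0 hornerC.
by rewrite /degenerate_falling big_ord_recl hornerM mul0r subr0 hornerX mul0r.
Qed.

(** The degenerate Vandermonde convolution.  In the induction step the new
    factor x + c - n lambda is split as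
    (x - i lambda) + (c - (n - i) lambda), each part extending one of the two
    factors, and Pascal's rule recombines the two sums. *)
Lemma degenerate_falling_shift lambda c n :
  degenerate_falling lambda n \Po ('X + c%:P) =
  \sum_(i < n.+1) ('C(n, i)%:R * (degenerate_falling lambda (n - i)).[c]) *:
    degenerate_falling lambda i.
Proof.
elim: n => [|n IHn].
  by rewrite big_ord1 /degenerate_falling !big_ord0 hornerC comp_polyC mulr1
    scale1r.
rewrite degenerate_fallingSr comp_polyM IHn.
rewrite comp_polyB comp_polyX comp_polyC.
pose F i := degenerate_falling lambda i.
pose G i := (F i).[c].
pose A i := ('C(n, i)%:R * G (n - i)%N) *: F i.+1.
pose B i := ('C(n, i)%:R * G (n.+1 - i)%N) *: F i.
transitivity (\sum_(i < n.+1) A i + \sum_(i < n.+1) B i).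
  rewrite mulr_suml -big_split; apply: eq_bigr => i _ /=.
  have lein : (i <= n)%N by rewrite -ltnS.
  rewrite /A /B /G /F (subSn lein) !degenerate_fallingSr hornerM hornerXsubC.
  rewrite natrB // -!mul_polyC !(polyCM, polyCB).
  ring.
(* The second sum is extended by its vanishing term i = n + 1. *)
have -> : \sum_(i < n.+1) B i = \sum_(i < n.+2) B i.
  by rewrite [RHS]big_ord_recr /= /B bin_small // mul0r scale0r addr0.
rewrite [X in _ + X]big_ord_recl [RHS]big_ord_recl addrCA -big_split /=.
congr (_ + _); first by rewrite /B !bin0.
apply: eq_bigr => i _; rewrite /A /B /G /F /bump /= add1n subSS -scalerDl.
by rewrite -mulrDl -natrD addnC -binS.
Qed.

Lemma forward_diffn_degenerate_falling lambda N n St :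
  degenerate_stirling2 lambda St -> (n < N)%N ->
  forward_diffn N (degenerate_falling lambda n) = 0.
Proof.
move=> -> ltnN; rewrite linear_sum big1 // => k _; rewrite linearZ /=.
rewrite forward_diffn_falling ffact_small ?scale0r ?scaler0 //.
exact: leq_trans (ltn_ord k) ltnN.
Qed.

Lemma euler_functional_degenerate_falling lambda N n St :
  degenerate_stirling2 lambda St -> (n < N)%N ->
  euler_functional N (degenerate_falling lambda n) =
    \sum_(k < n.+1) St n k * (-1) ^+ k * k`!%:R * 2 ^- k.
Proof.
move=> -> ltnN; rewrite linear_sum; apply: eq_bigr => k _.
rewrite linearZ /= euler_functional_falling ?mulrA //.
exact: leq_trans (ltn_ord k) ltnN.
Qed.

(** * Exponential generating functions *)

Lemma factr_neq0 n : n`!%:R != 0 :> R.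
Proof. by rewrite pnatr_eq0 -lt0n fact_gt0. Qed.

Lemma coef_egf_mul (a b : nat -> R) n :
  fps_coef (egf a * egf b) n =
    (\sum_(i < n.+1) 'C(n, i)%:R * (a i * b (n - i)%N)) / n`!%:R.
Proof.
rewrite mulr_suml; apply: eq_bigr => i _ /=.
have lein : (i <= n)%N by rewrite -ltnS.
rewrite -(bin_fact lein) !natrM.
have C_neq0 : 'C(n, i)%:R != 0 :> R by rewrite pnatr_eq0 -lt0n bin_gt0.
by field; rewrite C_neq0 !factr_neq0.
Qed.

(** The recurrence is the coefficientwise form of
    [egf a * (degenerate_exp lambda + 1) = 2]. *)
Lemma degenerate_euler_unique lambda (a : nat -> R) :
  (forall n,
    \sum_(i < n.+1) 'C(n, i)%:R * (a i * (degenerate_falling lambda (n - i)).[1])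
      + a n = 2 * (n == 0)%:R) ->
  forall n, degenerate_euler lambda n = a n.
Proof.
move=> rec_a n.
have eq2 : egf a * (degenerate_exp lambda + 1) = 2.
  rewrite mulrDr mulr1; apply: fpsP => m.
  transitivity (fps_coef (egf a * degenerate_exp lambda) m + a m / m`!%:R) => //.
  rewrite coef_egf_mul -mulrDl rec_a /=.
  by case: m => [|m]; rewrite /= ?fact0; field; rewrite // factr_neq0.
rewrite /degenerate_euler -eq2 mulrK ?degenerate_exp1_unit //=.
by rewrite mulrC mulfVK ?factr_neq0.
Qed.

End UmbralEuler.

Theorem theorem2p5 (R : realType) (lambda : R) (St : nat -> nat -> R)
    (hlambda : lambda != 0) (hS : degenerate_stirling2 lambda St) (n : nat) :
  degenerate_euler lambda n =
    \sum_(k < n.+1) St n k * (-1) ^+ k * k`!%:R * 2 ^- k.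
Proof.
pose a m := \sum_(k < m.+1) St m k * (-1) ^+ k * k`!%:R * 2 ^- k.
apply: (@degenerate_euler_unique _ _ a) => {}n.
have aE m : (m <= n)%N ->
    euler_functional n.+1 (degenerate_falling lambda m) = a m.
  by move=> lemn; rewrite (euler_functional_degenerate_falling hS).
rewrite -(degenerate_falling_horner0 lambda) -(@euler_functional_shift _ n.+1);
  last exact: (forward_diffn_degenerate_falling hS).
rewrite -polyC1 degenerate_falling_shift linear_sum (aE n) //; congr (_ + _).
apply: eq_bigr => i _; rewrite linearZ /= aE -1?ltnS //.
by rewrite -mulrA [_.[1] * _]mulrC.
Qed.
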